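(* In general, weak convergence $P_\alpha \rightarrow_w P$ on $(\mathcal{F}, \tau_{uF})$ does not imply $P_\alpha \rightarrow_w P$ on $(\mathcal{F}, \tau_{F})$; that is, there exist a non-empty locally compact, second-countable Hausdorff space $E$, a net $(P_\alpha)$ of probability measures on $(\mathcal{F},\mathcal{B}_F)$ and a probability measure $P$ on $(\mathcal{F},\mathcal{B}_F)$ such that $P_\alpha \rightarrow_w P$ on $(\mathcal{F}, \tau_{uF})$ but not $P_\alpha \rightarrow_w P$ on $(\mathcal{F}, \tau_{F})$.
   Context: For a non-empty locally compact, second-countable Hausdorff space $(E,\mathcal{G})$, $\mathcal{G}$ is the family of its open sets, and $\mathcal{F}$ and $\mathcal{K}$ are the families of all closed and all compact subsets of $E$. For $A\subseteq E$ put $\mathcal{M}(A)=\{F\in\mathcal{F}: F\cap A=\emptyset\}$ and $\mathcal{H}(A)=\{F\in\mathcal{F}: F\cap A\neq\emptyset\}$. The Fell topology $\tau_F$ on $\mathcal{F}$ is generated by $\{\mathcal{M}(K):K\in\mathcal{K}\}\cup\{\mathcal{H}(G):G\in\mathcal{G}\}$; the upper Fell topology $\tau_{uF}$ on $\mathcal{F}$ is generated by $\{\mathcal{M}(K):K\in\mathcal{K}\}$. Their Borel $\sigma$-algebras coincide: $\mathcal{B}_F:=\sigma(\tau_F)=\sigma(\tau_{uF})$. Weak convergence: for a topological space $(X,\mathcal{O})$ and a net $(P_\alpha)_{\alpha\in A}$ ($A$ a directed set) of probability measures and a probability measure $P$ on $(X,\sigma(\mathcal{O}))$, $P_\alpha\rightarrow_w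 P$ on $(X,\mathcal{O})$ means convergence in the weak topology, i.e. the initial topology on the set of probability measures with respect to the maps $P\mapsto P(O)$, $O\in\mathcal{O}$, into $\mathbb{R}$ with the topology $\{(a,\infty):a\in\mathbb{R}\}\cup\{\emptyset,\mathbb{R}\}$. Equivalently: $\liminf_\alpha P_\alpha(O)\ge P(O)$ for all $O\in\mathcal{O}$; equivalently: $\limsup_\alpha P_\alpha(F)\le P(F)$ for all closed sets $F$ of $(X,\mathcal{O})$. *)

(* Defs.v *)
From HB Require Import structures.
From mathcomp Require Import all_boot all_order all_algebra finmap.
From mathcomp Require Import all_classical all_reals all_analysis.

Set Implicit Arguments.
Unset Strict Implicit.
Unset Printing Implicit Defensive.

Import Order.TTheory GRing.Theory Num.Theory.
Import numFieldNormedType.Exports.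

Local Open Scope classical_set_scope.
Local Open Scope ring_scope.

Definition directed (A : Type) (le : A -> A -> Prop) : Prop :=
  [/\ inhabited A,
      forall a, le a a,
      forall a b c, le a b -> le b c -> le a c
    & forall a b, exists c, le a c /\ le b c].

Definition tail_filter (A : Type) (le : A -> A -> Prop) : set_system A :=
  [set S | exists a, forall b, le a b -> S b].

(* The real line with the topology consisting of the rays ]a, +oo[, the empty
   set and the whole line; convergence to x in it means x <= liminf. *)
Definition lower_reals (R : realType) : Type := R.

Section lower_reals_topology.
Variable R : realType.

Definition lower_open : set_system (lower_reals R) :=
  [set U | [\/ U = set0, U = setT | exists a : R, U = [set x : R | a < x]]].

Let lower_openT : lower_open setT. Proof. by apply: Or32. Qed.

Let lower_openI : setI_closed lower_open.
Proof.
move=> U V [->|->|[a ->]] [->|->|[b ->]];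
  rewrite ?set0I ?setI0 ?setTI ?setIT;
  try by [apply: Or31|apply: Or32|apply: Or33; eexists].
apply: Or33; exists (Num.max a b).
by apply/seteqP; split=> x /=; rewrite gt_max => /andP.
Qed.

Let lower_open_bigU (I : Type) (f : I -> set (lower_reals R)) :
  (forall i, lower_open (f i)) -> lower_open (\bigcup_i f i).
Proof.
move=> fo; set U := \bigcup_i f i.
have up (x y : R) : x <= y -> U x -> U y.
  move=> xy [i _ fix_]; exists i => //; move: fix_.
  by case: (fo i) => [->|->|[a ->]] //= ax; exact: lt_le_trans xy.
have nomin (x : R) : U x -> U = setT \/ exists2 y : R, y < x & U y.
  move=> [i _ fix_]; case: (fo i) fix_ => [->//|fT _|[a fa]].
    by left; apply/seteqP; split=> // y _; exists i => //; rewrite fT.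
  rewrite fa /= => ax; right; have := midf_lt ax; move: (_ / _) => y [ay yx].
  by exists y => //; exists i => //; rewrite fa.
have [/eqP U0|/set0P[u Uu]] := boolP (U == set0); first by apply: Or31.
have [UT|UNT] := pselect (U = setT); first by apply: Or32.
have [l Ul] : exists l : R, ~ U l.
  by apply/existsNP => allU; apply: UNT; apply/seteqP; split.
have lbl : lbound U l.
  by move=> x Ux; rewrite leNgt; apply/negP => /ltW /up /(_ Ux).
have hU : has_inf (U : set R) by split; [exists u|exists l].
apply: Or33; exists (inf (U : set R)); apply/seteqP; split=> x /=.
  move=> Ux; have [//|[y yx Uy]] := nomin x Ux.
  by apply: le_lt_trans yx; apply: ge_inf => //; exists l.
move=> infx; have e0 : 0 < x - inf (U : set R) by rewrite subr_gt0.
have [y Uy] := inf_adherent e0 hU.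
by rewrite addrC subrK => /ltW /up; exact.
Qed.

HB.instance Definition _ := Choice.on (lower_reals R).
HB.instance Definition _ :=
  isOpenTopological.Build (lower_reals R)
    lower_openT lower_openI lower_open_bigU.

End lower_reals_topology.

(* The type of probability measures on T, with the initial topology for the
   maps P |-> P O, O ranging over the open sets O of a topology tau on T, with
   values in lower_reals. Only meaningful when tau is contained in the
   sigma-algebra of T. *)
Definition weak_topology d (T : measurableType d) (R : realType)
    (tau : set (set T)) : Type :=
  sup_topology (fun O : tau => Topological.on
    (initial_topology (fun P : probability T R =>
       fine (P (val O)) : lower_reals R))).

HB.instance Definition _ d (T : measurableType d) (R : realType)
    (tau : set (set T)) :=
  Topological.on (@weak_topology d T R tau).

Definition weak_cvg d (T : measurableType d) (R : realType)
    (A : Type) (le : A -> A -> Prop) (P_ : A -> probability T R)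
    (P : probability T R) (tau : set (set T)) : Prop :=
  (P_ : A -> weak_topology R tau) @ tail_filter le
    --> (P : weak_topology R tau).

Definition closed_sets (E : topologicalType) : Type :=
  [set F : set E | closed F].

HB.instance Definition _ (E : topologicalType) := Choice.on (closed_sets E).

Lemma closed_sets_set0 (E : topologicalType) :
  set0 \in [set F : set E | closed F].
Proof. by rewrite inE /=; exact: closed0. Qed.

HB.instance Definition _ (E : topologicalType) :=
  isPointed.Build (closed_sets E) (exist _ set0 (closed_sets_set0 E)).

Definition miss (E : topologicalType) (A : set E) : set (closed_sets E) :=
  [set F | val F `&` A = set0].

Definition hit (E : topologicalType) (A : set E) : set (closed_sets E) :=
  [set F | val F `&` A !=set0].

Definition upper_fell_subbase (E : topologicalType) :
  set (set (closed_sets E)) := [set miss K | K in compact].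

Definition fell_subbase (E : topologicalType) : set (set (closed_sets E)) :=
  [set miss K | K in compact] `|` [set hit G | G in open].

Definition fell (E : topologicalType) : Type := closed_sets E.

Definition upper_fell (E : topologicalType) : Type := closed_sets E.

HB.instance Definition _ (E : topologicalType) := Pointed.on (fell E).
HB.instance Definition _ (E : topologicalType) :=
  isSubBaseTopological.Build (fell E) (@fell_subbase E) id.

HB.instance Definition _ (E : topologicalType) := Pointed.on (upper_fell E).
HB.instance Definition _ (E : topologicalType) :=
  isSubBaseTopological.Build (upper_fell E) (@upper_fell_subbase E) id.

Definition tau_F (E : topologicalType) : set (set (closed_sets E)) :=
  @open (fell E).
Arguments tau_F : clear implicits.

Definition tau_uF (E : topologicalType) : set (set (closed_sets E)) :=
  @open (upper_fell E).
Arguments tau_uF : clear implicits.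

(* sigma_tau_F below: for a locally compact, second-countable, Hausdorff E the
   topologies tau_F and tau_uF generate this same sigma-algebra. *)
Definition borel_F (E : topologicalType) : Type :=
  g_sigma_algebraType (tau_F E).

HB.instance Definition _ (E : topologicalType) := Measurable.on (borel_F E).

Lemma tau_uF_sub (E : topologicalType) : tau_uF E `<=` tau_F E.
Proof.
move=> A [B BD <-]; exists B => //= X /BD [F FD <-]; exists F => //.
by move=> x /FD; rewrite !inE => ?; left.
Qed.

Lemma tau_uF_miss (E : topologicalType) (K : set E) :
  compact K -> tau_uF E (miss K).
Proof.
move=> cK; exists [set miss K]; last by rewrite bigcup_set1.
move=> _ ->; exists [fset miss K]%fset; last by rewrite set_fset1 bigcap_set1.
by move=> x; rewrite in_fset1 => /eqP ->; rewrite inE; exists K.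
Qed.

Lemma missP (E : topologicalType) (A : set E) (F : closed_sets E) :
  miss A F <-> forall x, val F x -> ~ A x.
Proof.
split=> [FA x Fx Ax|FA]; first by have : set0 x by rewrite -FA.
by apply/seteqP; split=> // x [/FA].
Qed.

Lemma relatively_compact_base (E : topologicalType) :
  locally_compact [set: E] -> @second_countable E -> hausdorff_space E ->
  exists g : nat -> set E,
  (forall n, open (g n) /\ compact (closure (g n))) /\
  forall (G : set E) x, open G -> G x -> exists2 n, g n x & closure (g n) `<=` G.
Proof.
move=> lcE [B cB [Bo Bx]] hE; have /countable_injP[f injf] := cB.
pose D := [set U | B U /\ compact (closure U)].
pose g n := xget set0 [set U | D U /\ f U = n].
exists g; split=> [n|G x oG Gx].
  rewrite /g; case: xgetP => [U _ [[BU cU] _]|_]; first by split=> //; exact: Bo.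
  by rewrite closure0; split; [exact: open0|exact: compact0].
have [V + [cV clV]] := lcE x I; rewrite withinET => Vx.
have GVx : nbhs x (G `&` V).
  by apply: filterI => //; exact: open_nbhs_nbhs.
have [W Wx WG] := compact_regular hE cV Vx GVx.
have [U [BU Ux] UW] := Bx x W Wx.
have UGV : closure U `<=` G `&` V by apply: subset_trans WG; exact: closureS.
have cU : compact (closure U).
  by apply: (subclosed_compact _ cV) => [|y /UGV[]//]; exact: closed_closure.
have gU : g (f U) = U.
  rewrite /g; case: xgetP => [U' _ [[BU' _] fU']|/(_ U) []//].
  by apply: injf fU'; rewrite inE.
by exists (f U); rewrite gU// => y /UGV[].
Qed.

Lemma sigma_tau_F (E : topologicalType) :
  locally_compact [set: E] -> @second_countable E -> hausdorff_space E ->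
  <<s tau_F E >> = <<s tau_uF E >>.
Proof.
move=> lcE scE hE; have [g [g1 g2]] := relatively_compact_base lcE scE hE.
pose T := g_sigma_algebraType (tau_uF E).
have mM (K : set E) : compact K -> measurable (miss K : set T).
  by move=> cK; apply: sub_sigma_algebra; exact: tau_uF_miss.
have mH (G : set E) : open G -> measurable (hit G : set T).
  move=> oG; rewrite (_ : hit G =
      \bigcup_(n in [set n | closure (g n) `<=` G]) ~` miss (closure (g n))).
    apply: bigcup_measurable => n _; apply: measurableC.
    by apply: mM; case: (g1 n).
  apply/seteqP; split=> [F [x [Fx Gx]]|F [n nG]].
    have [n gx nG] := g2 _ _ oG Gx; exists n => //.
    by move=> /missP/(_ _ Fx); apply; exact: subset_closure.
  by move=> /eqP/set0P[x [Fx gx]]; exists x; split=> //; exact: nG.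
pose b (p : seq nat * seq nat) : set T :=
  [set F | (forall n, n \in p.1 -> miss (closure (g n)) F) /\
           (forall n, n \in p.2 -> hit (g n) F)].
have mb p : measurable (b p).
  rewrite (_ : b p = (\bigcap_(n in [set` p.1]) miss (closure (g n))) `&`
                     (\bigcap_(n in [set` p.2]) hit (g n))) //.
  by apply: measurableI; apply: bigcap_measurableType => n _;
    [apply: mM|apply: mH]; case: (g1 n).
have subb (F : T) (A : set T) : fell_subbase A -> A F ->
    exists2 p, b p F & b p `<=` A.
  move=> [[K cK <-] /missP FK|[G oG <-] [x [Fx Gx]]]; last first.
    have [n gx nG] := g2 _ _ oG Gx; exists ([::], [:: n]) => [|F' [_ /=]].
      by split=> // m; rewrite inE => /eqP ->; exists x.
    move=> /(_ n); rewrite inE eqxx => /(_ isT) [y [F'y gy]].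
    by exists y; split=> //; apply/nG/subset_closure.
  have clF : closed (val F) by have := valP F; rewrite inE.
  have : cover_compact K.
    have [->|/set0P[x0 _]] := eqVneq K set0.
      by move=> I D f _ _; exists fset0 => // x; rewrite inE.
    pose pE := isPointed.Build E x0.
    pose E' : ptopologicalType := HB.pack (E : Type) E pE.
    by change (@cover_compact E' K); rewrite -(@compact_cover E').
  move=> /(_ _ [set n | closure (g n) `<=` ~` val F] g).
  case=> [n _|x Kx|s sF Ks]; first by case: (g1 n).
    have nFx : (~` val F) x by move=> /FK.
    have [n gx nF] := g2 _ _ (closed_openC clF) nFx.
    by exists n.
  exists (enum_fset s, [::]) => [|F' [/= sF' _]].
    split=> //= n /sF; rewrite inE => nF.
    by apply/missP => x Fx /nF.
  apply/missP => x F'x /Ks[n /= ns gx].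
  by have /(missP _ F')/(_ _ F'x) := sF' _ ns; apply; exact: subset_closure.
have finb (F : T) (l : seq (set T)) :
    (forall A, A \in l -> fell_subbase A /\ A F) ->
    exists2 p, b p F & forall A, A \in l -> b p `<=` A.
  elim: l => [|A l ih] Al; first by exists ([::], [::]).
  have [|p pF pl] := ih; first by move=> A' A'l; apply: Al; rewrite inE A'l orbT.
  have [sA AF] := Al A (mem_head _ _).
  have [q qF qA] := subb _ _ sA AF.
  exists (p.1 ++ q.1, p.2 ++ q.2).
    by split=> n /=; rewrite mem_cat => /orP[];
      [apply pF.1|apply qF.1|apply pF.2|apply qF.2].
  move=> A'; rewrite inE => /orP[/eqP ->|/pl pA'] F' [/= h1 h2].
    by apply: qA; split=> n nq; [apply: h1|apply: h2]; rewrite mem_cat nq orbT.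
  by apply: pA'; split=> n nq; [apply: h1|apply: h2]; rewrite mem_cat nq.
apply/seteqP; split; last first.
  by apply: sub_sigma_algebra2; exact: tau_uF_sub.
apply: smallest_sub; first exact: smallest_sigma_algebra.
move=> O [C CD OE].
rewrite (_ : O = \bigcup_(p in [set p | b p `<=` O]) b p); last first.
  apply/seteqP; split=> [F OF|F [p pO]]; last exact: pO.
  have [X CX XF] : (\bigcup_(X in C) X) F by rewrite OE.
  have [s sD sX] := CD _ CX.
  have [|p pF ps] := finb F (enum_fset s).
    move=> A As; split; first by have := sD _ As; rewrite inE.
    have sF : (\bigcap_(i in [set` s]) i) F.
      by have : X F := XF; rewrite -sX; exact.
    exact: sF.
  exists p => // F' pF'; rewrite -OE; exists X => //.
  suff : (\bigcap_(i in [set` s]) i) F'.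
    by move=> h; suff : X F' by []; rewrite -sX; exact: h.
  by move=> A /= As; exact: ps pF'.
rewrite bigcup_mkcond.
suff : measurable
    (\bigcup_p (if p \in [set p | b p `<=` O] then b p else set0)) by [].
by apply: countable_bigcupT_measurable => // p; case: ifP.
Qed.

(* Main.v *)
Require Import Defs.
From HB Require Import structures.
From mathcomp Require Import all_boot all_order all_algebra finmap.
From mathcomp Require Import all_classical all_reals all_analysis.

(** The upper Fell topology is far from Hausdorff: its open sets are stable
    under passing to smaller closed sets ([tau_uF_sub_closed]), so every
    non-empty one contains the empty set.  Hence [\d_set0 O >= \d_F O] for
    every upper Fell open set [O] and every closed set [F], and the constant
    net [\d_set0] converges weakly to [\d_F] for the upper Fell topology
    ([weak_cvg_dirac_set0]).  For the Fell topology this fails as soon as [F]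
    is non-empty, since [hit setT] is Fell open, contains [F] and does not
    contain the empty set ([not_weak_cvg_dirac_set0]).  Any non-empty space
    therefore gives a counterexample; the discrete space [bool] is taken
    below.  Both convergence claims go through the liminf description of weak
    convergence ([weak_cvgP]). *)

Set Implicit Arguments.
Unset Strict Implicit.
Unset Printing Implicit Defensive.

Import Order.TTheory GRing.Theory Num.Theory.

Local Open Scope classical_set_scope.
Local Open Scope ring_scope.

Lemma tail_filter_filter (A : Type) (le : A -> A -> Prop) :
  directed le -> Filter (tail_filter le).
Proof.
move=> [[a0] refl_le trans_le ub_le]; split.
- by exists a0.
- move=> S T [a aS] [b bT]; have [c [ac bc]] := ub_le a b.
  by exists c => d cd; split; [apply/aS/(trans_le _ _ _ ac)
                              |apply/bT/(trans_le _ _ _ bc)].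
- by move=> S T ST [a aS]; exists a => b /aS/ST.
Qed.

(** Weak convergence says that [P O <= liminf_a P_ a O] for all [O] in
    [tau]. *)
Lemma weak_cvgP d (T : measurableType d) (R : realType) (A : Type)
    (le : A -> A -> Prop) (P_ : A -> probability T R) (P : probability T R)
    (tau : set (set T)) : directed le ->
  weak_cvg le P_ P tau <->
  forall (O : set T) (b : R), tau O -> b < fine (P O) ->
    exists a0, forall a, le a0 a -> b < fine (P_ a O).
Proof.
move=> /tail_filter_filter le_filter; split.
- move=> cvP O b tauO bP.
  have tauO' : O \in tau by rewrite inE.
  have /cvg_sup/(_ (exist _ O tauO')) cvO := cvP.
  pose f (Q : probability T R) : lower_reals R := fine (Q O).
  have nbP : nbhs (f P) ([set x : R | b < x] : set (lower_reals R)).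
    by apply: open_nbhs_nbhs; split=> //; apply: Or33; exists b.
  exact: cvO (@initial_continuous _ _ f P _ nbP).
- move=> liminf_ge; apply/cvg_sup => -[V tauV] S /=.
  have {}tauV : tau V by rewrite inE in tauV.
  pose f (Q : probability T R) : lower_reals R := fine (Q V).
  move=> PS; have : nbhs (P : initial_topology f) S := PS.
  rewrite nbhsE => -[_ [[U oU <-] PU] US].
  suff : tail_filter le [set a | U (fine (P_ a V))].
    by apply: filterS => a /US.
  case: oU PU => [->//|->|[b ->]] /=; first by move=> _; exact: filterT.
  exact: liminf_ge.
Qed.

Lemma tau_uF_sub_closed (E : topologicalType) (O : set (closed_sets E))
    (F G : closed_sets E) :
  tau_uF E O -> val G `<=` val F -> O F -> O G.
Proof.
move=> [C CD OE] GF OF.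
have [X CX XF] : (\bigcup_(X in C) X) F by rewrite OE.
have [s sD sX] := CD _ CX.
rewrite -OE; exists X => //.
have sF : (\bigcap_(i in [set` s]) i) F by have : X F := XF; rewrite -sX; exact.
suff sG : (\bigcap_(i in [set` s]) i) G.
  by suff : X G by []; rewrite -sX; exact: sG.
move=> M sM; have := sF.
move=> /(_ M sM); have := sD _ sM; rewrite inE => -[K cK <-].
by move=> /missP FK; apply/missP => x /GF; exact: FK.
Qed.

Lemma tau_F_hit (E : topologicalType) (G : set E) : open G -> tau_F E (hit G).
Proof.
move=> oG; exists [set hit G]; last by rewrite bigcup_set1.
move=> _ ->; exists [fset hit G]%fset; last by rewrite set_fset1 bigcap_set1.
by move=> x; rewrite in_fset1 => /eqP ->; rewrite inE; right; exists G.
Qed.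

(** In the next two lemmas [point] is the empty set, the distinguished element
    of [closed_sets E]. *)
Lemma weak_cvg_dirac_set0 (E : topologicalType) (R : realType) (A : Type)
    (le : A -> A -> Prop) (F : closed_sets E) : directed le ->
  weak_cvg le (fun=> \d_(point : borel_F E) : probability (borel_F E) R)
    (\d_(F : borel_F E) : probability (borel_F E) R) (tau_uF E).
Proof.
move=> dle; apply/weak_cvgP => // O b OuF bF.
have [[a0] _ _ _] := dle; exists a0 => a _; apply: (lt_le_trans bF).
rewrite /= !indicE ler_nat.
have [FO|//] := boolP ((F : borel_F E) \in O); rewrite inE in FO.
rewrite (_ : (point : borel_F E) \in O = true) //; apply/mem_set.
by apply: (tau_uF_sub_closed OuF _ FO) => x.
Qed.

Lemma not_weak_cvg_dirac_set0 (E : topologicalType) (R : realType) (A : Type)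
    (le : A -> A -> Prop) (F : closed_sets E) : directed le -> val F !=set0 ->
  ~ weak_cvg le (fun=> \d_(point : borel_F E) : probability (borel_F E) R)
      (\d_(F : borel_F E) : probability (borel_F E) R) (tau_F E).
Proof.
move=> dle [x Fx] /weak_cvgP-/(_ dle) /(_ (hit setT) 0 (tau_F_hit openT)).
have [_ refl_le _ _] := dle.
rewrite /= !indicE mem_set; last by exists x.
move=> /(_ ltr01) [a0 /(_ a0 (refl_le a0))].
by rewrite memNset ?ltxx// => -[y []].
Qed.

Lemma discrete_second_countable (T : discreteTopologicalType) :
  countable [set: T] -> @second_countable T.
Proof.
move=> cT; exists [set [set x] | x in [set: T]].
  exact: sub_countable (card_image_le _ _) cT.
split=> [U _|x U Ux]; first exact: discrete_open.
exists [set x]; first by split=> //; exists x.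
by move=> _ ->; exact: nbhs_singleton.
Qed.

Lemma compact_locally_compact (T : topologicalType) :
  compact [set: T] -> locally_compact [set: T].
Proof.
move=> cT x _; exists setT; first exact: filterT.
by split; [exact: cT | exact: closedT].
Qed.

Theorem corollary3 (R : realType) :
  exists (E : topologicalType),
    [/\ [set: E] !=set0, locally_compact [set: E], @second_countable E,
        hausdorff_space E
      & exists (A : Type) (le : A -> A -> Prop)
          (P_ : A -> probability (borel_F E) R) (P : probability (borel_F E) R),
        [/\ directed le,
            weak_cvg le P_ P (tau_uF E)
          & ~ weak_cvg le P_ P (tau_F E)]].
Proof.
exists bool; split.
- by exists true.
- exact/compact_locally_compact/bool_compact.
- exact/discrete_second_countable/countableP.
- exact: discrete_hausdorff.
have dle : directed (fun _ _ : unit => True).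
  by split=> // _ _; exists tt.
have cT : [set: bool] \in [set F : set bool | closed F].
  by rewrite inE; exact: closedT.
pose F : closed_sets bool := exist _ setT cT.
exists unit, (fun _ _ => True), (fun=> \d_(point : borel_F bool)),
  (\d_(F : borel_F bool)); split=> //.
  exact: weak_cvg_dirac_set0.
by apply: not_weak_cvg_dirac_set0 => //; exists true.
Qed.
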